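(* Consider the randomly switched system $\dot x = f_\sigma(x,d)$, $(x(0),\sigma(0)) = (x_0,\sigma_0)$, $t\ge 0$, generated by a random switching signal $\sigma$ from the finite family $\{f_i\}_{i\in\mathcal P}$. Suppose that (G1) $\sigma$ belongs to class G, with constants $\overline\lambda,\widetilde\lambda>0$ and $k_0\in\mathbb N\cup\{0\}$; (G2) there exist continuously differentiable functions $V_i:\mathbb R^n\to\mathbb R_{\ge 0}$, $i\in\mathcal P$, functions $\alpha_1,\alpha_2,\chi\in\mathcal K_\infty$, and numbers $\mu\ge 1$ and $\lambda_\circ>0$ such that for all $i,j\in\mathcal P$, $x\in\mathbb R^n$, $d\in\mathbb R^k$: $$\alpha_1(\|x\|)\le V_i(x)\le\alpha_2(\|x\|),\qquad \frac{\partial V_i}{\partial x}(x)f_i(x,d)\le-\lambda_\circ V_i(x)+\chi(\|d\|),\qquad V_i(x)\le\mu V_j(x);$$ (G3) $\mu<(\widetilde\lambda+\lambda_\circ)/\overline\lambda$. Then there exist functions $\beta\in\mathcal{KL}$ and $\alpha,\gamma\in\mathcal K_\infty$ such that for every $x_0\in\mathbb R^n$ and every measurable essentially bounded $d:\mathbb R_{\ge 0}\to\mathbb R^k$ there is a monotonically nondecreasing sequence $(T_i)_{i\in\mathbb N}$ of $(\mathfrak F_t)_{t\ge 0}$-optional times with $\lim_{i\to\infty}T_i=\infty$ almost surely such that, with $T_0:=0$, $$\mathsf E\left[\alpha(\|x(t)\|)\,\mathbf 1_{\{t\in[T_{i-1},T_i[\}\cap\{T_{i-1}<\infty\}}\right]\le\max\left\{\beta(\|x_0\|,t),\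 \gamma\bigl(\|d\|_{\mathbb R_{\ge 0}}\bigr)\right\}$$ for all $t\ge 0$ and all $i\in\mathbb N$.
   Context: Notation: $\mathbb N=\{1,2,\ldots\}$; $\mathbb R_{\ge 0}=[0,\infty[$; $\|\cdot\|$ is the Euclidean norm; $\|d\|_{A}$ is the essential supremum norm of $d$ on $A\subseteq\mathbb R_{\ge0}$; $\mathbf 1_A$ is the indicator of the event $A$. A function $\alpha:\mathbb R_{\ge0}\to\mathbb R_{\ge0}$ is in class $\mathcal K$ if it is (strictly) increasing, continuous and $\alpha(0)=0$; it is in class $\mathcal K_\infty$ if in addition it is unbounded. A function $\beta:\mathbb R_{\ge0}^2\to\mathbb R_{\ge0}$ is in class $\mathcal{KL}$ if $\beta(\cdot,s)\in\mathcal K$ for each $s$ and $\beta(r,s)\searrow 0$ as $s\to\infty$ for each $r$. Setting: $(\Omega,\mathfrak F,\mathsf P)$ is a probability space. $\mathcal P=\{1,\ldots,\mathrm N\}$ is a finite index set; each $f_i:\mathbb R^n\times\mathbb R^k\to\mathbb R^n$ is continuously differentiable with $f_i(0,0)=0$. The disturbance $d$ is a deterministic function of time. A random switching signal $\sigma$ is a càdlàg stochastic process with values in $\mathcal P$ such that for each $t\ge0$ and $\omega\in\Omega$ there is $\epsilon(t,\omega)>0$ with $\sigma(t+s,\omega)=\sigma(t,\omega)$ for $s\in[0,\epsilon(t,\omega)[$. $(\mathfrak F_t)_{t\ge0}$ is the (right-continuous) filtration generated by $\sigma$, with $\mathfrak F_0$ augmented by all $\mathsf P$-null sets; the filtered space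 is complete and satisfies the usual conditions. For each $\omega$, $x(\cdot)$ is the (Carathéodory) solution of $\dot x(t)=f_{\sigma(t)}(x(t),d(t))$ with $x(0)=x_0$. A $[0,\infty]$-valued random variable $\tau$ is an $(\mathfrak F_t)$-stopping time if $\{\tau\le t\}\in\mathfrak F_t$ for each $t\ge0$, and an $(\mathfrak F_t)$-optional time if $\{\tau<t\}\in\mathfrak F_t$ for each $t>0$. Class G: $N_\sigma(t_2,t_1)$ denotes the number of jumps of $\sigma$ on $]t_1,t_2]$. The switching signal $\sigma$ belongs to class G if there exist $\overline\lambda,\widetilde\lambda>0$ and $k_0\in\mathbb N\cup\{0\}$ such that for every $(\mathfrak F_t)$-stopping time $t'$, all $s\ge 0$ and all integers $k\ge k_0$, $$\mathsf P\bigl(N_\sigma(t'+s,t')=k\,\big|\,\mathfrak F_{t'}\bigr)\le e^{-\widetilde\lambda s}\frac{(\overline\lambda s)^k}{k!}$$ (on the event $\{t'<\infty\}$). *)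

(* Defs.v *)
(* MathComp-Analysis, over an arbitrary [R : realType]. *)
From HB Require Import structures.
From mathcomp Require Import all_boot all_order all_algebra.
From mathcomp Require Import all_classical all_reals all_analysis.
From mathcomp Require Import ess_sup_inf.

Set Implicit Arguments.
Unset Strict Implicit.
Unset Printing Implicit Defensive.

Import Order.TTheory GRing.Theory Num.Theory.
Import numFieldNormedType.Exports.

Local Open Scope classical_set_scope.
Local Open Scope ring_scope.

(* The library norm on ['rV[R]_n] is the sup norm; it induces the same topology
   and the same derivatives. *)
Definition enorm (R : realType) (n : nat) (x : 'rV[R]_n) : R :=
  Num.sqrt (\sum_(j < n) x 0 j ^+ 2).

(* Comparison functions are total functions on [R]; only their restriction to
   the nonnegative half-line matters. Nonnegativity there follows from
   [a 0 = 0] and monotonicity. *)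
Definition classK (R : realType) (a : R -> R) : Prop :=
  [/\ a 0 = 0,
      {within `[0, +oo[%classic, continuous a} &
      forall r s : R, 0 <= r -> r < s -> a r < a s].

Definition classKinf (R : realType) (a : R -> R) : Prop :=
  classK a /\ forall M : R, exists2 r : R, 0 <= r & M < a r.

(* Monotonicity in the second argument is weak since [b 0 s = 0] for all [s]. *)
Definition classKL (R : realType) (b : R -> R -> R) : Prop :=
  (forall s : R, 0 <= s -> classK (fun r => b r s)) /\
  (forall r : R, 0 <= r ->
    (forall s t : R, 0 <= s -> s <= t -> b r t <= b r s) /\
    b r s @[s --> +oo] --> (0 : R)).

(* In finite dimension, continuity of [y |-> 'd g y v] for every vector [v] is
   continuity of the derivative in operator norm (take [v] in a basis). *)
Definition C1 (R : realType) (U W : normedModType R) (g : U -> W) : Prop :=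
  (forall y : U, differentiable g y) /\
  (forall v : U, continuous (fun y : U => 'd g y v)).

(* Componentwise Lebesgue measurability on the nonnegative half-line. The
   library's [measurable] on [R] is Borel measurability, hence the
   Caratheodory sigma-algebra of Lebesgue outer measure on the domain side. *)
Definition lebesgue_measurable_signal (R : realType) (k : nat)
    (d : R -> 'rV[R]_k) : Prop :=
  forall (j : 'I_k) (Y : set R), measurable Y ->
    ((wlength (@idfun R))^*)%mu.-cara.-measurable
      (`[0, +oo[%classic `&` (fun t => d t 0 j) @^-1` Y).

(* The library's [ess_sup] is taken over the whole measure space, hence the
   restricted measure. *)
Definition ess_norm (R : realType) (k : nat) (d : R -> 'rV[R]_k) : \bar R :=
  ess_sup (mrestr (@lebesgue_measure R) (measurable_itv `[(0:R), +oo[))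
          (fun t => (enorm (d t))%:E).

(* Degenerate intervals [u i = v i] contribute nothing to either sum. *)
Definition abs_continuous_on (R : realType) (n : nat) (x : R -> 'rV[R]_n)
    (a b : R) : Prop :=
  forall eps : R, 0 < eps -> exists2 delta : R, 0 < delta &
    forall (m : nat) (u v : 'I_m -> R),
      (forall i, [/\ a <= u i, u i <= v i & v i <= b]) ->
      trivIset setT (fun i => `]u i, v i[%classic) ->
      \sum_(i < m) (v i - u i) < delta ->
      \sum_(i < m) enorm (x (v i) - x (u i)) < eps.

Definition caratheodory_solution (R : realType) (n : nat)
    (F : R -> 'rV[R]_n -> 'rV[R]_n) (x0 : 'rV[R]_n) (x : R -> 'rV[R]_n) : Prop :=
  [/\ x 0 = x0,
      forall b : R, 0 < b -> abs_continuous_on x 0 b &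
      {ae (@lebesgue_measure R), forall t : R,
         0 <= t -> is_derive t (1 : R) x (F t (x t))}].

Section switching.
Context {disp : measure_display} {Omega : measurableType disp} {R : realType}.
Variable P : probability Omega R.

(* The finite index set is discrete: the second clause contains
   right-continuity, and existence of a left limit means being constant on a
   left neighbourhood. *)
Definition switching_signal (N : nat) (sigma : R -> Omega -> 'I_N) : Prop :=
  [/\ forall (t : R) (i : 'I_N), 0 <= t -> measurable (sigma t @^-1` [set i]),
      forall (w : Omega) (t : R), 0 <= t ->
        exists2 eps : R, 0 < eps &
          forall s : R, 0 <= s -> s < eps -> sigma (t + s) w = sigma t w &
      forall (w : Omega) (t : R), 0 < t ->
        exists i : 'I_N, \forall s \near t^'-, sigma s w = i].

(* sigma-algebra generated by [sigma s], [0 <= s <= t], and the P-null sets *)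
Definition augmented_history (N : nat) (sigma : R -> Omega -> 'I_N) (t : R) :
    set (set Omega) :=
  <<s [set A | exists (s : R) (i : 'I_N), [/\ 0 <= s, s <= t & A = sigma s @^-1` [set i]]]
      `|` P.-negligible >>.

(* Right-continuous filtration generated by [sigma]. For a switching signal the
   augmented history is already right-continuous; intersecting over [u > t]
   makes this hold by construction. *)
Definition filtration_of (N : nat) (sigma : R -> Omega -> 'I_N) (t : R) :
    set (set Omega) :=
  [set A | forall u : R, t < u -> augmented_history sigma u A].

Definition stopping_time (F : R -> set (set Omega)) (tau : Omega -> \bar R) :
    Prop :=
  (forall w, (0 <= tau w)%E) /\
  (forall t : R, 0 <= t -> F t [set w | (tau w <= t%:E)%E]).

Definition optional_time (F : R -> set (set Omega)) (tau : Omega -> \bar R) :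
    Prop :=
  (forall w, (0 <= tau w)%E) /\
  (forall t : R, 0 < t -> F t [set w | (tau w < t%:E)%E]).

Definition stopped_sigma_algebra (F : R -> set (set Omega))
    (tau : Omega -> \bar R) : set (set Omega) :=
  [set A | measurable A /\
           forall t : R, 0 <= t -> F t (A `&` [set w | (tau w <= t%:E)%E])].

(* [g] is a version of the conditional probability of [B] given the
   sub-sigma-algebra [G]. *)
Definition is_cond_prob (G : set (set Omega)) (B : set Omega) (g : Omega -> R) :
    Prop :=
  [/\ forall Y : set R, measurable Y -> G (g @^-1` Y),
      P.-integrable setT (EFin \o g) &
      forall A : set Omega, G A ->
        (\int[P]_(w in A) (g w)%:E = P (A `&` B))%E].

(* Values in a discrete set: no jump at [s] means that [sigma] agrees with
   [sigma s] on a left neighbourhood of [s]. *)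
Definition jumps (N : nat) (sigma : R -> Omega -> 'I_N) (w : Omega) (t1 t2 : R) :
    set R :=
  [set s | [/\ t1 < s, s <= t2 & ~ \forall u \near s^'-, sigma u w = sigma s w]].

(* The event that tau is finite and that exactly [k] jumps occur on
   ]tau, tau + s]. *)
Definition njumps_event (N : nat) (sigma : R -> Omega -> 'I_N)
    (tau : Omega -> \bar R) (s : R) (k : nat) : set Omega :=
  [set w | (tau w < +oo)%E /\
           (jumps sigma w (fine (tau w)) (fine (tau w) + s) #= `I_k)%card].

(* Versions of a conditional probability agree almost surely, so it does not
   matter which version satisfies the bound. *)
Definition classG (N : nat) (sigma : R -> Omega -> 'I_N) (lbar ltil : R)
    (k0 : nat) : Prop :=
  forall tau : Omega -> \bar R, stopping_time (filtration_of sigma) tau ->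
  forall s : R, 0 <= s -> forall k : nat, (k0 <= k)%N ->
  exists g : Omega -> R,
    is_cond_prob (stopped_sigma_algebra (filtration_of sigma) tau)
                 (njumps_event sigma tau s k) g /\
    {ae P, forall w, (tau w < +oo)%E ->
       g w <= expR (- ltil * s) * ((lbar * s) ^+ k / k`!%:R)}.

End switching.

(* Main.v *)
Require Import Defs.
From HB Require Import structures.
From mathcomp Require Import all_boot all_order all_algebra.
From mathcomp Require Import finmap.
From mathcomp Require Import all_classical all_reals all_analysis.
From mathcomp Require Import ess_sup_inf measurable_realfun ring lra.

Set Implicit Arguments.
Unset Strict Implicit.
Unset Printing Implicit Defensive.

Import Order.TTheory GRing.Theory Num.Theory.
Import numFieldNormedType.Exports.

Local Open Scope classical_set_scope.
Local Open Scope ring_scope.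

(** The stopping times are T_i = +oo for all i >= 1: the bound to be proved
    holds for the whole trajectory at once, that is, for the expectation of
    alpha1(|x(t)|) itself, and so the first window [0, +oo[ already carries
    everything.

    Along one sample path, V_{sigma(t)}(x(t)) decays at rate lo between two
    switching instants up to a source term chi(|d|), and is multiplied by at
    most mu at each of them.  With y(t) = e^{lo t} V_{sigma(t)}(x(t)) and
    b = chi(|d|) / lo this gives, N(s, t) being the number of jumps on ]s, t],
      y(t) <= mu^N(s,t) (y(s) + b (e^{lo t} - e^{lo s})).
    Class G, used at deterministic times s only, bounds the law of N(s, t) by a
    Poisson-like law from the rank k0 on, hence
      E mu^N(s,t) <= mu^k0 + e^{(mu lbar - ltil) (t - s)}.
    The variation of constants formula would involve the integral over s of
    mu^N(s,t) e^{-lo (t - s)}.  As N(s, t) is nonincreasing in s, that integral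
    is replaced, at the price of a constant factor, by a sum over the grid
    t, t - 1, t - 2, ..., 0; thus only finitely many random variables are
    involved and no joint measurability is required.  Taking expectations,
    the j-th term of the sum is dominated, up to the factor e^{lo}, by
    mu^k0 e^{-lo j} + e^{-c j} with c = ltil + lo - mu lbar > 0, and the two
    geometric series converge; this is where the smallness condition on mu
    enters.

    Three points need a proof of their own.
    - The Lyapunov inequality is available only almost everywhere in time
      (lyapunov_decay).  An absolutely continuous function whose derivative is
      almost everywhere nonpositive is nonincreasing
      (ae_derive_le0_nonincreasing); V composed with x is absolutely continuous
      because V is Lipschitz on balls (C1_lipschitz_on_ball).
    - The jumps on ]s, t] are finite in number (njumps_exists), and the events
      N(s, t) = k are measurable (measurable_jump_count): N(s, t) is the
      eventual number of changes of sigma along finer and finer grids.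
      The integral identity defining a conditional probability says something
      on the actual law of N(s, t) only once this is known.
    - The state x(t) is not known to be a measurable function of the sample
      point.  Since the integral of a nonnegative function is a supremum over
      the simple functions below it, a measurable upper bound is enough
      (ge0_le_integral_nonmeasurable). *)

(** * Monotonicity of absolutely continuous functions *)

(** Compactness of the segment in the form of an induction: if every point t
    has a neighbourhood across which S is transported from the left of t to
    the right of t, then the supremum of the points reached from a is b.  It
    replaces the choice of a partition subordinate to a gauge. *)
Lemma local_to_global_induction (R : realType) (a b : R) (S : R -> Prop) :
  a <= b -> S a ->
  (forall t, a <= t <= b -> exists2 e : R, 0 < e &
     forall r s, a <= r -> s <= b -> t - e < r -> r <= t -> t <= s -> s < t + e ->
       S r -> S s) ->
  S b.
Proof.
move=> ab Sa ext; pose A := [set r | a <= r <= b /\ S r].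
have supA : has_sup A.
  split; first by exists a; split; rewrite ?lexx.
  by exists b => r [/andP[]].
have ac : a <= sup A by apply: sup_upper_bound => //; split; rewrite ?lexx.
have cb : sup A <= b by apply: ge_sup; [exact: supA.1|move=> r [/andP[]]].
have [e e0 He] := ext (sup A) (introT andP (conj ac cb)).
have [r [/andP[ar rb] Sr] cr] := sup_adherent e0 supA.
have rc : r <= sup A by apply: sup_upper_bound => //; split=> //; rewrite ar.
have [cltb|] := ltP (sup A) b; last first.
  move=> bc; have <- : sup A = b by apply/eqP; rewrite eq_le cb.
  by apply: (He r) => //; lra.
pose s := Num.min b (sup A + e / 2).
have sb : s <= b by rewrite /s ge_min lexx.
have cs : sup A < s by rewrite /s lt_min cltb /=; lra.
have se : s < sup A + e by rewrite /s gt_min; apply/orP; right; lra.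
have Ss : S s by apply: (He r) => //; lra.
have : s <= sup A by apply: sup_upper_bound => //; split=> //; apply/andP; lra.
by lra.
Qed.

Definition real_abs_continuous_on (R : realType) (g : R -> R) (a b : R) : Prop :=
  forall eps : R, 0 < eps -> exists2 delta : R, 0 < delta &
    forall (m : nat) (u v : 'I_m -> R),
      (forall i, [/\ a <= u i, u i <= v i & v i <= b]) ->
      trivIset setT (fun i => `]u i, v i[%classic) ->
      \sum_(i < m) (v i - u i) < delta ->
      \sum_(i < m) `|g (v i) - g (u i)| < eps.

(** Turns a covering of small measure into the smallness of the total length
    that absolute continuity asks for. *)
Lemma sum_length_le_measure (R : realType) (m : nat) (u v : 'I_m -> R)
    (U : set R) :
  measurable U -> (forall i, u i <= v i) ->
  trivIset setT (fun i => `]u i, v i[%classic) ->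
  (forall i, `]u i, v i[ `<=` U) ->
  ((\sum_(i < m) (v i - u i))%:E <= lebesgue_measure U)%E.
Proof.
move=> mU uv tI sub.
have -> : (\sum_(i < m) (v i - u i))%:E
    = lebesgue_measure (\big[setU/set0]_(i < m) `]u i, v i[%classic).
  rewrite measure_semi_additive_ord//=; last first.
    exact: bigsetU_measurable.
  rewrite -sumEFin; apply: eq_bigr => i _.
  rewrite lebesgue_measure_itv/= lte_fin; case: ltP => // vu.
  have -> : v i = u i by apply/eqP; rewrite eq_le vu uv.
  by rewrite subrr.
apply: le_measure; rewrite ?inE//.
  exact: bigsetU_measurable.
by apply: (big_ind (fun A => A `<=` U)) => // A B AU BU; rewrite subUset.
Qed.

(** The increment is taken across t, with r <= t <= s, which is what the
    induction on the segment needs: the difference quotients at t on both sides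
    are added up. *)
Lemma is_derive_le0_local (R : realType) (g : R -> R) (t l eps : R) :
  0 < eps -> l <= 0 -> is_derive t 1 g l ->
  exists2 e : R, 0 < e & forall r s, t - e < r -> r <= t -> t <= s -> s < t + e ->
    g s - g r <= eps * (s - r).
Proof.
move=> eps0 l0 [dg gl].
have cv : (h^-1 *: ((g \o shift t) (h *: 1) - g t)) @[h --> 0^'] --> l.
  by rewrite -gl; exact: dg.
move: cv => /cvgr_dist_lt/(_ _ eps0).
rewrite /dnbhs /within /= => /nbhs_ballP[e /= e0 He].
have key h : h != 0 -> `|h| < e -> h^-1 * (g (h + t) - g t) < eps.
  move=> h0 he; have := He h; rewrite /ball/= sub0r normrN => /(_ he h0).
  rewrite /GRing.scale/= mulr1 => /ltr_normlP[]; lra.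
exists e => // r s tr rt ts st.
have Hs : g s - g t <= eps * (s - t).
  have [->|st0] := eqVneq s t; first by rewrite !subrr mulr0.
  have st1 : 0 < s - t by rewrite subr_gt0 lt_neqAle eq_sym st0.
  have := key (s - t) (lt0r_neq0 st1).
  rewrite gtr0_norm// subrK => /(_ ltac:(lra)).
  by rewrite mulrC ltr_pdivrMr// => /ltW.
have Hr : g t - g r <= eps * (t - r).
  have [->|st0] := eqVneq r t; first by rewrite !subrr mulr0.
  have st1 : r - t < 0 by rewrite subr_lt0 lt_neqAle st0.
  have := key (r - t) (ltr0_neq0 st1).
  rewrite ltr0_norm// subrK => /(_ ltac:(lra)).
  by rewrite mulrC ltr_ndivrMr// => /ltW; lra.
by lra.
Qed.

(** Cover the exceptional null set, enlarged by the two endpoints, by an open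
    set U of measure less than delta.  Moving from a to b, an increment across a
    point outside the null set is at most eps times its length; an increment
    across a point of the null set is recorded as an interval contained in U.
    The recorded intervals are disjoint, hence of total length less than delta,
    and absolute continuity bounds their total contribution by eps. *)
Lemma ae_derive_le0_nonincreasing (R : realType) (g : R -> R) (a b : R) :
  a <= b -> real_abs_continuous_on g a b ->
  {ae @lebesgue_measure R, forall t, a < t -> t < b ->
     exists2 l : R, l <= 0 & is_derive t (1 : R) g l} ->
  g b <= g a.
Proof.
move=> ab acg aeg.
suff main (eps : R) : 0 < eps -> g b - g a <= eps * (b - a) + eps.
  rewrite -subr_le0; apply/ler_addgt0Pl => e e0.
  (* the summand 1 keeps the divisor positive when a = b *)
  pose c := b - a + 1; have c0 : 0 < c by rewrite /c; lra.
  have := main (e / c) (divr_gt0 e0 c0).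
  have -> : e / c * (b - a) + e / c = e.
    by rewrite -[X in _ + X]mulr1 -mulrDr -/c divfK// gt_eqF.
  by rewrite addr0.
move=> eps0.
have [delta delta0 Hdelta] := acg _ eps0.
have {aeg} [E [mE E0 subE]] := aeg.
pose E' := E `|` [set a; b].
have mE' : measurable E' by apply: measurableU => //; exact: measurableU.
have E'0 : lebesgue_measure E' = 0%E.
  apply: null_set_setU => //; first exact: measurableU.
  by apply: null_set_setU => //; exact: lebesgue_measure_set1.
have [U [oU EU Udelta]] : exists U : set R,
    [/\ open U, E' `<=` U & (lebesgue_measure U < delta%:E)%E].
  have [U [oU EU HU]] := lebesgue_regularity_outer mE'
     (eq_ind_r (fun z => z < +oo)%E (ltry 0) E'0) delta0.
  exists U; split => //; have mU := open_measurable oU.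
  rewrite -(setDUK EU); apply: le_lt_trans (measureU2 _ _ _) _ => //.
    exact: measurableD.
  by rewrite /= [X in (X + _)%E]E'0 add0e.
have mU : measurable U by exact: open_measurable.
(* the intervals recorded on the way from a to r, the latest one first *)
pose fam (r : R) (s : seq (R * R)) :=
  [/\ forall p, p \in s -> [/\ a <= p.1, p.1 <= p.2, p.2 <= r & `]p.1, p.2[ `<=` U] &
      pairwise (fun p q => q.2 <= p.1) s].
pose S r := exists2 s, fam r s &
  g r - g a <= eps * (r - a) + \sum_(p <- s) `|g p.2 - g p.1|.
have [s [Hs1 Hs2] Hs3] : S b.
  apply: (@local_to_global_induction _ a) => //.
    exists [::]; first by split.
    by rewrite big_nil !subrr mulr0 addr0.
  move=> t /andP[at_ tb].
  have [tE|tE] := pselect (E' t).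
    (* ]r, s[ lies in U as soon as r and s are close to t: record it *)
    have /nbhs_ballP[e /= e0 He] : nbhs t U by apply: open_nbhs_nbhs; split=> //; exact: EU.
    exists e => // r s ar sb tr rt ts st [l [l1 l2] l3].
    exists ((r, s) :: l); last first.
      rewrite big_cons /=; have := ler_norm (g s - g r).
      have : eps * (r - a) <= eps * (s - a) by apply: ler_wpM2l; [exact: ltW|lra].
      by lra.
    split.
      move=> p; rewrite inE => /predU1P[->/=|/l1[p1 p2 p3 p4]]; last by split=> //; lra.
      split=> //; [by lra|move=> z /=; rewrite in_itv/= => /andP[rz zs]].
      by apply: He; rewrite /ball/= distrC ltr_distl; apply/andP; lra.
    by rewrite /= l2 andbT; apply/allP => p /l1[].
  have [l l0 dl] : exists2 l : R, l <= 0 & is_derive t (1:R) g l.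
    apply/not_notP => nt; apply: tE.
    have [<-|ta] := eqVneq a t; first by right; left.
    have [->|tb'] := eqVneq t b; first by right; right.
    left; apply: subE => /= /(_ _ _)H; apply: nt; apply: H.
      by rewrite lt_neqAle ta.
    by rewrite lt_neqAle tb'.
  have [e e0 He] := is_derive_le0_local eps0 l0 dl.
  exists e => // r s ar sb tr rt ts st [z [l1 l2] l3].
  exists z; first by split=> // p /l1[p1 p2 p3 p4]; split=> //; lra.
  by have := He r s tr rt ts st; lra.
apply: (le_trans Hs3); rewrite lerD2l; apply/ltW.
rewrite big_tnth.
pose u (i : 'I_(size s)) := (tnth (in_tuple s) i).1.
pose v (i : 'I_(size s)) := (tnth (in_tuple s) i).2.
have Hi i : [/\ a <= u i, u i <= v i, v i <= b & `]u i, v i[ `<=` U].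
  by apply: Hs1; exact: mem_tnth.
have tI : trivIset setT (fun i => `]u i, v i[%classic).
  have ord (i j : 'I_(size s)) : (i < j)%N -> v j <= u i.
    move=> ij; have := @pairwiseP _ _ (0, 0) s Hs2 i j (ltn_ord i) (ltn_ord j) ij.
    by rewrite /u /v !(tnth_nth (0, 0)).
  have disj (i j : 'I_(size s)) : (i < j)%N -> `]u i, v i[ `&` `]u j, v j[ = set0.
    move=> /ord vu; apply/seteqP; split=> // z /= [].
    by rewrite !in_itv/= => /andP[z1 z2] /andP[z3 z4]; lra.
  apply/trivIsetP => i j _ _; rewrite -val_eqE /= neq_ltn => /orP[/disj//|/disj].
  by rewrite setIC.
apply: (Hdelta _ u v) => //; first by move=> i; have [] := Hi i.
rewrite -lte_fin; apply: le_lt_trans Udelta.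
by apply: sum_length_le_measure => // i; have [] := Hi i.
Qed.

(** * Decay of a Lyapunov function along an absolutely continuous solution *)

Lemma normr_coord_le_enorm (R : realType) (n : nat) (y : 'rV[R]_n) (j : 'I_n) :
  `|y 0 j| <= enorm y.
Proof.
rewrite -sqrtr_sqr ler_sqrt; last by apply: sumr_ge0 => i _; exact: sqr_ge0.
by rewrite (bigD1 j)//= lerDl; apply: sumr_ge0 => i _; exact: sqr_ge0.
Qed.

Lemma enorm_ge0 (R : realType) (n : nat) (y : 'rV[R]_n) : 0 <= enorm y.
Proof. exact: sqrtr_ge0. Qed.

Lemma normr_le_enorm (R : realType) (n : nat) (y : 'rV[R]_n) :
  `|y| <= enorm y.
Proof.
rewrite /Num.norm /= mx_normrE; apply/bigmax_leP; split; first exact: enorm_ge0.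
by move=> [i j] _ /=; rewrite ord1; exact: normr_coord_le_enorm.
Qed.

Lemma continuous_bounded_on_ball (R : realType) (n : nat) (h : 'rV[R]_n -> R)
    (M : R) :
  continuous h -> exists L : R, forall y : 'rV[R]_n, `|y| <= M -> `|h y| <= L.
Proof.
move=> ch.
have cK : compact [set y : 'rV[R]_n | `|y| <= M].
  apply: bounded_closed_compact.
    exists M; split; first exact: num_real.
    by move=> x Mx y /= /le_trans; apply; exact: ltW.
  rewrite (_ : mkset _ = Num.norm @^-1` [set x : R | x <= M])//.
  by apply: preimage_closed; [move=> x _; exact: norm_continuous|exact: closed_le].
have /compact_bounded[L [_ HL]] : compact (h @` [set y : 'rV[R]_n | `|y| <= M]).
  by apply: continuous_compact => //; apply: continuous_subspaceT.
by exists (L + 1) => y yM; apply: (HL (L + 1)); [rewrite ltrDl|exists y].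
Qed.

Lemma is_derive_comp_differentiable (R : realType) (n : nat)
    (V : 'rV[R]_n -> R) (c : R -> 'rV[R]_n) (t : R) (w : 'rV[R]_n) :
  differentiable V (c t) -> is_derive t (1 : R) c w ->
  is_derive t (1 : R) (V \o c) ('d V (c t) w).
Proof.
move=> dV [dc cw].
have dc' : differentiable c t by apply/derivable1_diffP.
have dVc : differentiable (V \o c) t by exact: differentiable_comp.
split; first exact/derivable1_diffP.
by rewrite deriveE// diff_comp//= -cw deriveE.
Qed.

(** Mean value theorem on the segment from y to z.  The differential is bounded
    on the ball because it is applied to the finitely many basis vectors, each
    of which gives a continuous function on a compact set. *)
Lemma C1_lipschitz_on_ball (R : realType) (n : nat) (V : 'rV[R]_n -> R) (M : R) :
  C1 V -> exists2 L : R, 0 <= L & forall y z : 'rV[R]_n, `|y| <= M -> `|z| <= M ->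
    `|V z - V y| <= L * enorm (z - y).
Proof.
move=> [dV cV].
have /choice[L HL] : forall j : 'I_n, exists L : R, forall y : 'rV[R]_n, `|y| <= M ->
    `|'d V y (delta_mx 0 j)| <= L.
  by move=> j; exact: continuous_bounded_on_ball.
exists (\sum_j `|L j|); first exact: sumr_ge0.
move=> y z yM zM.
pose c (h : R) := y + h *: (z - y).
have dc (h : R) : is_derive h (1 : R) c (z - y).
  have dh : is_derive h (1 : R) (fun s : R => s *: (z - y)) (z - y).
    have dl : differentiable (fun s : R => s *: (z - y)) h.
      by apply: differentiableZl.
    apply: DeriveDef; first exact/derivable1_diffP.
    by rewrite deriveE// diffZl// diff_val scale1r.
  have -> : c = cst y + (fun s : R => s *: (z - y)) by apply/funext.
  by rewrite -[z - y in X in is_derive _ _ _ X]add0r; exact: is_deriveD.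
have dVc (h : R) : is_derive h (1 : R) (V \o c) ('d V (c h) (z - y)).
  exact: is_derive_comp_differentiable.
have [//|h] := @MVT R (V \o c) (fun h => 'd V (c h) (z - y)) 0 1 ltr01 (fun h _ => dVc h).
  apply: derivable_within_continuous => h _.
  by have [] := dVc h.
rewrite in_itv/= => /andP[h0 h1].
rewrite /= /c scale0r scale1r addr0 addrCA subrr addr0 subr0 mulr1 => ->.
have cM : `|y + h *: (z - y)| <= M.
  have -> : y + h *: (z - y) = (1 - h) *: y + h *: z.
    by rewrite scalerBr scalerBl scale1r addrA addrAC.
  apply: (le_trans (ler_normD _ _)); rewrite !normrZ (gtr0_norm h0) gtr0_norm ?subr_gt0//.
  have : (1 - h) * `|y| <= (1 - h) * M by apply: ler_wpM2l => //; lra.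
  have : h * `|z| <= h * M by apply: ler_wpM2l => //; lra.
  by lra.
rewrite [X in 'd V _ X]row_sum_delta linear_sum /=.
apply: (le_trans (ler_norm_sum _ _ _)); rewrite mulr_suml; apply: ler_sum => j _.
rewrite linearZ /= normrM mulrC; apply: ler_pM => //.
  by apply: (le_trans (HL j _ cM)); exact: ler_norm.
exact: normr_coord_le_enorm.
Qed.

(** Needed to stay in a ball on which V is Lipschitz. *)
Lemma abs_continuous_bounded (R : realType) (n : nat) (x : R -> 'rV[R]_n)
    (a b : R) :
  a <= b -> abs_continuous_on x a b ->
  exists M : R, forall t, a <= t <= b -> `|x t| <= M.
Proof.
move=> ab acx.
have [delta delta0 Hd] := acx 1 ltr01.
have close u v : a <= u -> u <= v -> v <= b -> v - u < delta -> `|x v - x u| <= 1.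
  move=> au uv vb vu; apply: (le_trans (normr_le_enorm _)); apply: ltW.
  have := Hd 1%N (fun=> u) (fun=> v); rewrite !big_ord1; apply => //.
  by apply/trivIsetP => i j _ _; rewrite !ord1 eqxx.
pose S r := exists M : R, forall t, a <= t <= r -> `|x t| <= M.
apply: (@local_to_global_induction _ a b S) => //.
  by exists `|x a| => t; rewrite -eq_le => /eqP ->.
move=> t _; exists (delta / 2); first by rewrite divr_gt0.
move=> r s ar sb tr rt ts st [M HM].
exists (Num.max M (`|x r| + 1)) => z /andP[az zs]; rewrite le_max.
have [zr|rz] := leP z r; first by rewrite HM ?az.
apply/orP; right.
have -> : x z = x r + (x z - x r) by rewrite addrC subrK.
by apply: (le_trans (ler_normD _ _)); rewrite lerD2l; apply: close; lra.
Qed.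

Lemma expR_increment_le (R : realType) (u v : R) :
  expR v - expR u <= expR v * (v - u).
Proof.
have := expR_ge1Dx (u - v).
have := expR_gt0 v; have : expR v * expR (u - v) = expR u by rewrite -expRD addrC subrK.
set A := expR v; set B := expR (u - v); move=> <- A0 B1.
have : A * (1 + (u - v)) <= A * B by apply: ler_wpM2l => //; exact: ltW.
by lra.
Qed.

(** The function g(t) = e^{lo t} (V(x(t)) - v / lo) has the derivative
    e^{lo t} ('d V(x(t)) x'(t) + lo V(x(t)) - v) <= 0 almost everywhere, and it
    inherits absolute continuity from x since both factors are Lipschitz
    functions of (t, x(t)) on the bounded set visited. *)
Lemma lyapunov_decay (R : realType) (n : nat) (V : 'rV[R]_n -> R)
    (x : R -> 'rV[R]_n) (lo v p q : R) :
  C1 V -> 0 < lo -> p <= q -> abs_continuous_on x p q ->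
  {ae @lebesgue_measure R, forall t, p < t -> t < q ->
     exists2 w : 'rV[R]_n, is_derive t (1 : R) x w & 'd V (x t) w <= - lo * V (x t) + v} ->
  expR (lo * q) * (V (x q) - v / lo) <= expR (lo * p) * (V (x p) - v / lo).
Proof.
move=> C1V lo0 pq acx aex.
have [M HM] := abs_continuous_bounded pq acx.
have [L L0 HL] := C1_lipschitz_on_ball M C1V.
have cV : continuous V by move=> y; apply: differentiable_continuous; exact: C1V.1.
have [B HB] := continuous_bounded_on_ball M cV.
pose D := `|B| + `|v / lo|.
have D0 : 0 <= D by rewrite addr_ge0.
have xM t : p <= t -> t <= q -> `|x t| <= M by move=> pt tq; apply: HM; rewrite pt.
have BD t : p <= t -> t <= q -> `|V (x t) - v / lo| <= D.
  move=> pt tq; apply: (le_trans (ler_normB _ _)); rewrite lerD2r.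
  by apply: (le_trans (HB _ (xM _ pt tq))); exact: ler_norm.
pose E := expR (lo * q); have E0 : 0 < E by exact: expR_gt0.
pose g t := expR (lo * t) * (V (x t) - v / lo).
have ginc s t : p <= s -> s <= t -> t <= q ->
    `|g t - g s| <= E * L * enorm (x t - x s) + D * (E * (lo * (t - s))).
  move=> ps st tq; have pt := le_trans ps st; have sq := le_trans st tq.
  have -> : g t - g s = expR (lo * t) * (V (x t) - V (x s)) +
     (V (x s) - v / lo) * (expR (lo * t) - expR (lo * s)) by rewrite /g; ring.
  have tE : expR (lo * t) <= E by rewrite ler_expR ler_pM2l.
  apply: (le_trans (ler_normD _ _)); rewrite !normrM; apply: lerD.
    rewrite -mulrA gtr0_norm ?expR_gt0//; apply: ler_pM => //.
    by apply: HL; exact: xM.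
  apply: ler_pM => //; first exact: BD.
  rewrite ger0_norm ?subr_ge0 ?ler_expR ?ler_pM2l//.
  apply: (le_trans (expR_increment_le _ _)); rewrite -mulrBr.
  by apply: ler_wpM2r => //; rewrite mulr_ge0 ?subr_ge0// ltW.
have acg : real_abs_continuous_on g p q.
  move=> eps eps0.
  (* the summands 1 make the divisors below positive *)
  pose K1 := E * L + 1; pose K2 := D * (E * lo) + 1.
  have K10 : 0 < K1 by rewrite /K1; have := mulr_ge0 (ltW E0) L0; lra.
  have K20 : 0 < K2.
    by rewrite /K2; have := mulr_ge0 D0 (ltW (mulr_gt0 E0 lo0)); lra.
  have [d1 d10 Hd1] := acx (eps / (2 * K1)) (divr_gt0 eps0 (mulr_gt0 (ltr0Sn R 1) K10)).
  exists (Num.min d1 (eps / (2 * K2))).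
    by rewrite lt_min d10 divr_gt0// mulr_gt0.
  move=> m u w uw tI; rewrite lt_min => /andP[l1 l2].
  apply: (@le_lt_trans _ _ (K1 * (\sum_(i < m) enorm (x (w i) - x (u i))) +
                          K2 * (\sum_(i < m) (w i - u i)))).
    rewrite !mulr_sumr -big_split /=; apply: ler_sum => i _.
    have [p1 p2 p3] := uw i; apply: (le_trans (ginc _ _ p1 p2 p3)).
    apply: lerD; first by apply: ler_wpM2r; [exact: enorm_ge0|rewrite /K1 lerDl].
    rewrite !mulrA; apply: ler_wpM2r; first by rewrite subr_ge0.
    by rewrite /K2 !mulrA lerDl.
  have h1 := Hd1 m u w uw tI l1.
  have : K1 * (\sum_(i < m) enorm (x (w i) - x (u i))) < eps / 2.
    by rewrite mulrC -ltr_pdivlMr//; move: h1; rewrite invfM mulrA.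
  have : K2 * (\sum_(i < m) (w i - u i)) < eps / 2.
    by rewrite mulrC -ltr_pdivlMr//; move: l2; rewrite invfM mulrA.
  by lra.
apply: (ae_derive_le0_nonincreasing pq acg).
case: aex => N [mN N0 HN]; exists N; split=> //.
apply: subset_trans HN; apply: subsetC => t H pt tq.
have [w dw Hw] := H pt tq.
have dVx : is_derive t (1 : R) (V \o x) ('d V (x t) w).
  by apply: is_derive_comp_differentiable => //; exact: C1V.1.
have de : is_derive t (1 : R) (fun s => expR (lo * s)) (expR (lo * t) * lo).
  apply: is_derive1_comp.
  have dl : is_derive t (1 : R) (lo \*: (id : R -> R)) (lo *: (1 : R)).
    exact: is_deriveZ.
  by apply: (is_derive_eq dl); rewrite /GRing.scale/= mulr1.
exists (expR (lo * t) * ('d V (x t) w) + (V (x t) - v / lo) * (expR (lo * t) * lo)).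
  have -> : expR (lo * t) * ('d V (x t) w) + (V (x t) - v / lo) * (expR (lo * t) * lo)
     = expR (lo * t) * ('d V (x t) w - (- lo * V (x t) + v)).
    by field; rewrite gt_eqF.
  by rewrite pmulr_rle0 ?expR_gt0// subr_le0.
have -> : g = (fun s => expR (lo * s)) * ((V \o x) - cst (v / lo)) by apply/funext.
have dB : is_derive t (1 : R) ((V \o x) - cst (v / lo)) ('d V (x t) w - 0).
  exact: is_deriveB.
apply: (is_derive_eq (is_deriveM de dB)).
by rewrite subr0.
Qed.

(** * Jumps of piecewise constant paths *)

(** Values are compared on open left neighbourhoods without naming the left
    limit. *)
Definition piecewise_constant (R : realType) (T : Type) (p : R -> T) : Prop :=
  (forall t : R, 0 <= t -> exists2 e : R, 0 < e & forall r : R, t <= r -> r < t + e -> p r = p t) /\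
  (forall t : R, 0 < t -> exists2 e : R, 0 < e &
     forall r r' : R, t - e < r -> r < t -> t - e < r' -> r' < t -> p r = p r').

(** The path p has exactly m jumps on ]s, t].  The derivation lists the jump
    times in order, so that it serves at the same time as a count and as the
    decomposition of [s, t] into intervals of constancy on which to argue by
    induction. *)
Inductive njumps (R : realType) (T : Type) (p : R -> T) : R -> R -> nat -> Prop :=
| njumps0 s t : s <= t -> (forall r, s <= r -> r <= t -> p r = p s) ->
    njumps p s t 0
| njumpsS s u t m : s < u -> (forall r, s <= r -> r < u -> p r = p s) ->
    p u <> p s -> njumps p u t m -> njumps p s t m.+1.

Lemma njumps_le (R : realType) (T : Type) (p : R -> T) (s t : R) (m : nat) :
  njumps p s t m -> s <= t.
Proof. by elim=> // {}s u {}t {}m su _ _ _ /(le_trans (ltW su)). Qed.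

Lemma njumps_cat (R : realType) (T : Type) (p : R -> T) (s t r : R) (m m' : nat) :
  njumps p s t m -> njumps p t r m' -> njumps p s r (m + m')%N.
Proof.
move=> J; elim: J r m' => {s t m} [s t st cst|s u t m su cst pu _ IH] r m' J'.
  rewrite add0n; case: J' st cst => {t r m'} [t r tr cst'|t u r m' tu cst' pu J'] st cst.
    apply: njumps0; first exact: le_trans tr.
    move=> z sz zr; have [zt|/ltW tz] := leP z t; first exact: cst.
    by rewrite cst'// cst.
  apply: (njumpsS _ _ _ J'); first exact: le_lt_trans tu.
    move=> z sz zu; have [zt|/ltW tz] := leP z t; first exact: cst.
    by rewrite cst'// cst.
  by rewrite -(cst t).
by rewrite addSn; exact: njumpsS (IH _ _ J').
Qed.

(** Near any time c the path is constant on the left and on the right of c, so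
    crossing c costs at most one jump. *)
Lemma njumps_exists (R : realType) (T : Type) (p : R -> T) (s t : R) :
  piecewise_constant p -> 0 <= s -> s <= t -> exists m, njumps p s t m.
Proof.
move=> [rp lp] s0 st.
apply: (@local_to_global_induction _ s t (fun r => exists m, njumps p s r m)) => //.
  exists 0%N; apply: njumps0 => // r sr rs.
  by congr p; apply/eqP; rewrite eq_le sr rs.
move=> c /andP[sc ct].
have [e1 e10 H1] := rp c (le_trans s0 sc).
have [e2 e20 H2] : exists2 e : R, 0 < e &
     forall r r' : R, s <= r -> c - e < r -> r < c -> c - e < r' -> r' < c -> p r = p r'.
  have [c0|c0] := leP c 0; last by have [e e0 He] := lp c c0; exists e => // *; apply: He.
  by exists 1 => // r r' sr _ rc; exfalso; lra.
exists (Num.min e1 e2) => [|r z sr zt]; first by rewrite lt_min e10.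
rewrite ltrBlDr -ltrBlDl lt_min => /andP[r1 r2] rc cz.
rewrite -ltrBlDl lt_min => /andP[z1 z2] [m Jm].
have [m' Jm'] : exists m', njumps p r c m'.
  move: rc; rewrite le_eqVlt => /predU1P[->|rc].
    exists 0%N; apply: njumps0 => // z' z1' z2'.
    by congr p; apply/eqP; rewrite eq_le z1' z2'.
  have cst z' : r <= z' -> z' < c -> p z' = p r by move=> *; apply: H2 => //; lra.
  have [pc|pc] := pselect (p c = p r).
    exists 0%N; apply: njumps0 => [|z' rz']; first exact: ltW.
    by rewrite le_eqVlt => /predU1P[->//|]; exact: cst.
  exists 1%N; apply: (njumpsS rc cst pc); apply: njumps0 => // z' z1' z2'.
  by congr p; apply/eqP; rewrite eq_le z1' z2'.
exists (m + m' + 0)%N; apply: njumps_cat (njumps_cat Jm Jm') _.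
by apply: njumps0 => // z' cz' z'z; apply: H1 => //; lra.
Qed.

(** Link with the set of jump times by which class G is expressed. *)
Lemma jumps_njumps (R : realType) (disp : measure_display)
    (Omega : measurableType disp) (N : nat)
    (sigma : R -> Omega -> 'I_N) (w : Omega) (s t : R) (m : nat) :
  njumps (sigma^~ w) s t m -> (jumps sigma w s t #= `I_m)%card.
Proof.
move=> J; suff [A -> Am] : exists2 A : {fset R},
    jumps sigma w s t = [set` A] & #|` A| = m by apply/card_eq_fsetP.
elim: J => {s t m} [s t st cst|s u t m su cst pu J [A JA Am]].
  exists fset0; last exact: cardfs0.
  rewrite set_fset0; apply/seteqP; split=> // r [sr rt]; apply.
  near=> z; rewrite (cst r)//; last exact: ltW.
  apply: cst; first by apply: ltW; near: z; exact: nbhs_left_gt.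
  by apply: le_trans rt; near: z; exact: nbhs_left_le.
(* near u on the left the path still has its value at s *)
have jumpu : ~ \forall z \near u^'-, sigma z w = sigma u w.
  move=> H; have [z [z1 z2 z3]] : exists z, [/\ s < z, z < u & sigma z w = sigma u w].
    near (u : R)^'- => z; exists z; split.
    - by near: z; exact: nbhs_left_gt.
    - by near: z; exact: nbhs_left_lt.
    - by near: z.
  by apply: pu; rewrite -z3 cst// ltW.
have nuA : u \notin A.
  by apply/negP => uA; have : [set` A] u by []; rewrite -JA => -[]; rewrite ltxx.
exists (u |` A)%fset; last by rewrite cardfsU1 nuA Am.
rewrite set_fsetU1 -JA; apply/seteqP; split=> r.
  move=> [sr rt nr]; have [ur|ru|->] := ltgtP u r; [by right|exfalso|by left].
  apply: nr; near=> z; rewrite (cst r) ?(ltW sr)//; apply: cst.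
    by apply: ltW; near: z; exact: nbhs_left_gt.
  by apply: lt_trans ru; near: z; exact: nbhs_left_lt.
move=> [->|[ur rt nr]]; first by split=> //; exact: njumps_le J.
by split=> //; exact: lt_trans ur.
Unshelve. all: by end_near. Qed.

(** The quantity computed by sampling the path at the times x :: l. *)
Fixpoint changes (R : realType) (T : eqType) (p : R -> T) (x : R) (l : seq R) : nat :=
  if l is y :: l' then ((p x != p y) + changes p y l')%N else 0%N.

Lemma path_le_last (R : realType) (x : R) (l : seq R) :
  path <=%R x l -> x <= last x l.
Proof. by elim: l x => //= y l IH x /andP[xy /IH]; exact: le_trans. Qed.

(** Take the mesh smaller than a time during which every mode entered at a jump
    persists.  Then at most one jump separates two successive sample times, and the
    sample time following a jump still shows the mode entered there. *)
Lemma changes_fine_mesh (R : realType) (T : eqType) (p : R -> T) (s t : R) (m : nat) :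
  piecewise_constant p -> 0 <= s -> njumps p s t m ->
  exists2 d : R, 0 < d & forall l, path <=%R s l -> last s l = t ->
    path (fun x y => y - x < d) s l -> changes p s l = m.
Proof.
move=> [rp _] s0 J; elim: J s0 => {s t m} [s t st cst|s u t m su cst pu J IH] s0.
  exists 1 => // l pl lt _.
  have : forall x, s <= x -> path <=%R x l -> last x l = t -> changes p x l = 0%N.
    elim: l {pl lt} => //= y l IH x sx /andP[xy pl] lt.
    have yt : y <= t by rewrite -lt; exact: path_le_last.
    rewrite IH//; last exact: le_trans xy.
    by rewrite (cst x) ?(cst y) ?eqxx//; [exact: le_trans xy|exact: le_trans yt].
  by apply.
have u0 : 0 <= u by exact: le_trans (ltW su).
have [d1 d10 H1] := IH u0; have [d2 d20 H2] := rp u u0.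
exists (Num.min d1 d2) => [|l]; first by rewrite lt_min d10.
(* generalizes the head of the sample to any time before the first jump u *)
have : forall x, s <= x -> x < u -> path <=%R x l -> last x l = t ->
    path (fun x y => y - x < Num.min d1 d2) x l -> changes p x l = m.+1.
  elim: l => /= [x _ xu _ xt _|y l IHl x sx xu /andP[xy pl] lt /andP[dxy dl]].
    by have := njumps_le J; rewrite -xt leNgt xu.
  have [yu|uy] := ltP y u.
    by rewrite IHl ?(le_trans sx)// (cst x)// (cst y) ?eqxx// (le_trans sx).
  move: dxy; rewrite lt_min => /andP[dxy1 dxy2].
  have py : p y = p u by apply: H2 => //; lra.
  rewrite (cst x)// py eq_sym (introN eqP pu) add1n; congr _.+1.
  rewrite -(H1 (y :: l)) /= ?uy ?py ?eqxx//; apply/andP; split; first lra.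
  by apply: sub_path dl => a b /=; rewrite lt_min => /andP[].
by move=> H pl lt dl; apply: H.
Qed.

(** The points s + (t - s) i / (n + 1) for i from 1 to n + 1; the left endpoint
    s is passed separately as the head of the path. *)
Definition grid (R : realType) (s t : R) (n : nat) : seq R :=
  [seq s + (t - s) / n.+1%:R * i%:R | i <- iota 1 n.+1].

Lemma path_grid (R : realType) (s h : R) (e : rel R) (k n : nat) :
  (forall i, e (s + h * i%:R) (s + h * i.+1%:R)) ->
  path e (s + h * k%:R) [seq s + h * i%:R | i <- iota k.+1 n].
Proof. by move=> He; elim: n k => //= n IH k; rewrite He IH. Qed.

Lemma last_grid (R : realType) (s t : R) (n : nat) : last s (grid s t n) = t.
Proof.
rewrite /grid -nth_last size_map size_iota (nth_map 0%N) ?size_iota// nth_iota//.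
by rewrite add1n divfK ?pnatr_eq0// addrC subrK.
Qed.

Lemma changes_grid (R : realType) (T : eqType) (p : R -> T) (s t : R) (m : nat) :
  piecewise_constant p -> 0 <= s -> njumps p s t m ->
  exists n0, forall n, (n0 <= n)%N -> changes p s (grid s t n) = m.
Proof.
move=> pp s0 J; have st := njumps_le J.
have [d d0 H] := changes_fine_mesh pp s0 J.
have [n0 Hn0] : exists n0 : nat, (t - s) / d < n0%:R.
  by exists (Num.bound ((t - s) / d)); apply: archi_boundP; rewrite divr_ge0 ?subr_ge0// ltW.
exists n0 => n n0n.
have eqs : s = s + (t - s) / n.+1%:R * 0%:R by rewrite mulr0 addr0.
apply: H; last 2 first.
- exact: last_grid.
- rewrite {1}eqs; apply: path_grid => i.
  rewrite -[i.+1%:R]natr1 mulrDr mulr1 addrA [X in X - _]addrC addrK.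
  rewrite ltr_pdivrMr// -ltr_pdivrMl// mulrC; apply: (lt_le_trans Hn0).
  by rewrite ler_nat (leq_trans n0n).
rewrite {1}eqs; apply: path_grid => i.
by rewrite lerD2l ler_wpM2l ?ler_nat// divr_ge0// subr_ge0.
Qed.

(** * Measurability and exponential moments of the number of jumps *)

Lemma switching_signal_piecewise_constant (R : realType) (disp : measure_display)
    (Omega : measurableType disp) (N : nat) (sigma : R -> Omega -> 'I_N)
    (w : Omega) :
  switching_signal sigma -> piecewise_constant (sigma^~ w).
Proof.
move=> [_ rc ll]; split=> t t0.
  have [e e0 He] := rc w t t0; exists e => // r tr re.
  by rewrite -(He (r - t)); [congr sigma; lra|lra|lra].
have [i Hi] := ll w t t0.
have {}Hi : nbhs (t^'-) [set s | sigma s w = i] by [].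
have /nbhs_ballP[e /= e0 He] : nbhs t [set s | s < t -> sigma s w = i] by [].
exists e => // r r' er rt er' rt'.
by rewrite !He// /ball/= ltr_distl; apply/andP; split; lra.
Qed.

Definition jump_count (R : realType) (Omega : Type) (N : nat)
    (sigma : R -> Omega -> 'I_N) (s t : R) (w : Omega) : nat :=
  xget 0%N [set m | njumps (sigma^~ w) s t m].

Section jump_count.
Context (R : realType) (disp : measure_display) (Omega : measurableType disp).
Context (N : nat) (sigma : R -> Omega -> 'I_N).
Context (hsigma : switching_signal sigma).

Lemma jump_countP (s t : R) (w : Omega) : 0 <= s -> s <= t ->
  njumps (sigma^~ w) s t (jump_count sigma s t w).
Proof.
move=> s0 st; have pc := switching_signal_piecewise_constant w hsigma.
by rewrite /jump_count; case: xgetP => // H; have [m /H] := njumps_exists pc s0 st.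
Qed.

Lemma jump_count_unique (s t : R) (w : Omega) (m : nat) : 0 <= s ->
  njumps (sigma^~ w) s t m -> jump_count sigma s t w = m.
Proof.
move=> s0 J; have := jump_countP w s0 (njumps_le J).
move=> /jumps_njumps J1; apply/card_eq_II.
by rewrite -(card_eql J1); exact: jumps_njumps J.
Qed.

Lemma jump_countD (s t r : R) (w : Omega) : 0 <= s -> s <= t -> t <= r ->
  jump_count sigma s r w = (jump_count sigma s t w + jump_count sigma t r w)%N.
Proof.
move=> s0 st tr; apply: jump_count_unique => //.
by apply: njumps_cat (jump_countP _ _ _) (jump_countP _ _ _) => //; exact: le_trans st.
Qed.

(** Only finitely many of the random variables sigma s are involved. *)
Lemma measurable_changes (x : R) (l : seq R) (m : nat) : 0 <= x ->
  (forall y, y \in l -> 0 <= y) ->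
  measurable [set w | changes (sigma^~ w) x l = m].
Proof.
elim: l x m => [x m _ _|y l IH x m x0 l0] /=.
  by have [->|m0] := eqVneq 0%N m; [rewrite (_ : mkset _ = setT)//; apply/seteqP|
    rewrite (_ : mkset _ = set0)//; apply/seteqP; split=> // w /= /eqP; rewrite (negbTE m0)].
have y0 : 0 <= y by apply: l0; rewrite inE eqxx.
have {}IH := fun m => IH y m y0 (fun z zl => l0 z (mem_behead (s := y :: l) zl)).
have mE : measurable [set w | sigma x w = sigma y w].
  rewrite (_ : mkset _ = \bigcup_(i in [set: 'I_N])
      (sigma x @^-1` [set i] `&` sigma y @^-1` [set i])).
    apply: fin_bigcup_measurable => // i _; apply: measurableI; have [ms _ _] := hsigma; exact: ms.
  apply/seteqP; split => [w /= H|w /= [i _ [-> ->]]//].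
  by exists (sigma x w).
rewrite (_ : mkset _ =
    ([set w | sigma x w = sigma y w] `&` [set w | changes (sigma^~ w) y l = m]) `|`
    (~` [set w | sigma x w = sigma y w] `&`
     [set w | (changes (sigma^~ w) y l).+1 = m])).
  apply: measurableU; first exact: measurableI.
  apply: measurableI; first exact: measurableC.
  case: m => [|m]; first by rewrite (_ : mkset _ = set0)//; apply/seteqP; split.
  rewrite (_ : mkset _ = [set w | changes (sigma^~ w) y l = m]); first exact: IH.
  by apply/seteqP; split=> w /=; [case|move=> ->].
apply/seteqP; split=> w /=.
  by have [H|H] := eqVneq (sigma x w) (sigma y w) => /= Hm; [left|right];
    split=> //; exact/eqP.
by move=> [[-> <-]|[/eqP/negbTE -> <-]]; rewrite ?eqxx.
Qed.

(** The number of changes along the n-th grid is eventually equal to the number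
    of jumps, so the event is a countable union of countable intersections. *)
Lemma measurable_jump_count (s t : R) (m : nat) : 0 <= s -> s <= t ->
  measurable [set w | jump_count sigma s t w = m].
Proof.
move=> s0 st.
rewrite (_ : mkset _ = \bigcup_n0 \bigcap_(n in [set n | (n0 <= n)%N])
    [set w | changes (sigma^~ w) s (grid s t n) = m]).
  apply: bigcup_measurable => n0 _; apply: bigcap_measurable => [|n _].
    by exists n0 => /=.
  apply: measurable_changes => // y /mapP[i _ ->].
  by rewrite addr_ge0// mulr_ge0// divr_ge0// subr_ge0.
have ev w := changes_grid (switching_signal_piecewise_constant w hsigma) s0 (jump_countP w s0 st).
apply/seteqP; split=> w /=.
  by move=> <-; have [n0 Hn0] := ev w; exists n0.
move=> [n0 _ Hn0]; have [n1 Hn1] := ev w.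
by rewrite -(Hn1 (maxn n0 n1)) ?leq_maxr//; apply: Hn0 => /=; exact: leq_maxl.
Qed.

Lemma measurable_fun_jump_count (s t : R) (f : nat -> R) : 0 <= s -> s <= t ->
  measurable_fun setT (fun w => f (jump_count sigma s t w)).
Proof.
move=> s0 st _ Y mY; rewrite setTI.
rewrite (_ : _ @^-1` Y = \bigcup_(m in [set m | Y (f m)])
   [set w | jump_count sigma s t w = m]).
  by apply: bigcup_measurable => m _; exact: measurable_jump_count.
apply/seteqP; split=> w /=; first by exists (jump_count sigma s t w).
by move=> [m Ym ->].
Qed.

End jump_count.

Section jump_moments.
Context (R : realType) (disp : measure_display) (Omega : measurableType disp).
Context (P : probability Omega R).
Context (N : nat) (sigma : R -> Omega -> 'I_N).
Context (hsigma : switching_signal sigma).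
Context (lbar ltil : R) (k0 : nat).
Context (hlbar : 0 < lbar) (hG : classG P sigma lbar ltil k0).

Lemma filtration_setT_set0 (t : R) :
  filtration_of P sigma t setT /\ filtration_of P sigma t set0.
Proof.
pose G u := [set A | exists (s : R) (i : 'I_N),
  [/\ 0 <= s, s <= u & A = sigma s @^-1` [set i]]] `|` P.-negligible.
split=> u _; have [G0 GC _] := @smallest_sigma_algebra Omega setT (G u).
  by have := GC _ G0; rewrite setD0.
exact: G0.
Qed.

(** Class G at the constant stopping time s; integrating the conditional
    probability over the whole space gives the unconditional one. *)
Lemma jump_count_tail (s t : R) (k : nat) : 0 <= s -> s <= t -> (k0 <= k)%N ->
  (P [set w | jump_count sigma s t w = k] <=
   (expR (- ltil * (t - s)) * ((lbar * (t - s)) ^+ k / k`!%:R))%:E)%E.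
Proof.
move=> s0 st kk0.
have cst_event u : filtration_of P sigma u [set w : Omega | (s%:E <= u%:E)%E].
  have [FT F0] := filtration_setT_set0 u.
  have [su|su] := boolP (s%:E <= u%:E)%E.
    by rewrite (_ : mkset _ = setT)//; apply/seteqP; split.
  by rewrite (_ : mkset _ = set0)//; apply/seteqP; split.
have stop : stopping_time (filtration_of P sigma) (fun=> s%:E).
  by split=> // w; rewrite lee_fin.
have ts0 : 0 <= t - s by rewrite subr_ge0.
have [g [[_ gint gB] gle]] := hG stop ts0 kk0.
set c := expR _ * _ in gle *.
have c0 : 0 <= c by rewrite mulr_ge0 ?expR_ge0// divr_ge0// exprn_ge0// mulr_ge0// ltW.
have -> : [set w | jump_count sigma s t w = k] = njumps_event sigma (fun=> s%:E) (t - s) k.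
  apply/seteqP; split=> w /=.
    move=> <-; split; first exact: ltry.
    rewrite /= addrC subrK; apply: jumps_njumps; exact: jump_countP.
  move=> [_]; rewrite /= addrC subrK => H.
  apply/card_eq_II; rewrite -(card_eqr H) card_eq_sym.
  by apply: jumps_njumps; exact: jump_countP.
have := gB setT; rewrite setTI => <-; last first.
  by split=> // u _; rewrite setTI; exact: cst_event.
have [mg _] := integrableP _ _ _ gint.
(* the version g may be negative; only its positive part is compared *)
rewrite integralE; apply: (@le_trans _ _ (\int[P]_w (fun x => (g x)%:E)^\+ w)%E).
  by rewrite -[leRHS]sube0; apply: leeB => //; exact: integral_ge0.
rewrite -[leRHS]mule1 -(@probability_setT _ _ _ P) -integral_cst//.
apply: ae_ge0_le_integral => //.
- exact: measurable_funepos.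
- case: gle => A [mA A0 HA]; exists A; split=> //.
  apply: subset_trans HA; apply: subsetC => w /(_ (ltry _)) gw _.
  by rewrite funeposE -EFin_max lee_fin ge_max gw.
Qed.

(** The values k < k0, about which class G says nothing, contribute at most
    mu^k0; for k >= k0 the tail bound sums to
    e^{-ltil r} times the exponential series of mu lbar r, with r = t - s. *)
Lemma exp_jump_moment (mu s t : R) : 1 <= mu -> 0 <= s -> s <= t ->
  (\int[P]_w (mu ^+ jump_count sigma s t w)%:E <=
   (mu ^+ k0 + expR ((mu * lbar - ltil) * (t - s)))%:E)%E.
Proof.
move=> mu1 s0 st; have mu0 : 0 < mu by exact: lt_le_trans mu1.
pose r := t - s; have r0 : 0 <= r by rewrite subr_ge0.
pose A k := [set w | jump_count sigma s t w = k].
have mA k : measurable (A k) by exact: measurable_jump_count.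
pose h (k : nat) (w : Omega) : \bar R :=
  if (k0 <= k)%N then ((mu ^+ k)%:E * (\1_(A k) w)%:E)%E else 0%E.
have h0 k w : (0 <= h k w)%E.
  by rewrite /h; case: ifP => // _; rewrite -EFinM lee_fin mulr_ge0 ?exprn_ge0// ltW.
have mh k : measurable_fun setT (h k).
  rewrite /h; case: (k0 <= k)%N; last exact: measurable_cst.
  apply: measurable_funeM.
  by apply/measurable_EFinP; exact: measurable_indic.
have ih k : (\int[P]_w h k w <=
    (expR (- ltil * r) * exp_coeff (mu * lbar * r) k)%:E)%E.
  rewrite /h; have [kk0|_] := boolP (k0 <= k)%N; last first.
    rewrite integral0 lee_fin mulr_ge0 ?expR_ge0//.
    by rewrite exp_coeff_ge0// !mulr_ge0// ltW.
  rewrite ge0_integralZl_EFin//; last 2 first.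
  - by apply/measurable_EFinP; exact: measurable_indic.
  - by rewrite exprn_ge0// ltW.
  rewrite integral_indic// setIT.
  have muk0 : (0 <= (mu ^+ k)%:E)%E by rewrite lee_fin exprn_ge0// ltW.
  apply: (le_trans (lee_wpmul2l muk0 (jump_count_tail s0 st kk0))).
  rewrite -EFinM lee_fin /exp_coeff /= -/r.
  rewrite -mulrA [in leRHS]exprMn mulrCA -[in leRHS]mulrA.
  by rewrite mulrA.
apply: (@le_trans _ _ (\int[P]_w ((mu ^+ k0)%:E + \sum_(0 <= k <oo) h k w))%E).
  apply: ge0_le_integral => //.
  - by move=> w _; rewrite lee_fin exprn_ge0// ltW.
  - by apply/measurable_EFinP; exact: (measurable_fun_jump_count _ (fun k => mu ^+ k)).
  - apply: emeasurable_funD; first exact: measurable_cst.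
    exact: ge0_emeasurable_sum.
  move=> w _; have [lt|ge] := ltnP (jump_count sigma s t w) k0.
    apply: (@le_trans _ _ (mu ^+ k0)%:E).
      by rewrite lee_fin ler_weXn2l// ltnW.
    by rewrite leeDl// nneseries_ge0.
  apply: (@le_trans _ _ (\sum_(0 <= k <oo) h k w)%E); last first.
    by rewrite leeDr// lee_fin exprn_ge0// ltW.
  apply: (@le_trans _ _ (h (jump_count sigma s t w) w)).
    by rewrite /h ge indicE mem_set// mule1.
  apply: le_trans (nneseries_lim_ge (jump_count sigma s t w).+1 _) => [|k _ _]; last exact: h0.
  by rewrite big_nat_recr//= leeDr// sume_ge0.
rewrite ge0_integralD//; last 3 first.
- by move=> w _; rewrite lee_fin exprn_ge0// ltW.
- by move=> w _; exact: nneseries_ge0.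
- exact: ge0_emeasurable_sum.
rewrite integral_cst//= [X in (_ * X)%E](_ : _ = 1%E); last exact: probability_setT.
rewrite mule1 EFinD leeD2l//.
rewrite integral_nneseries//.
apply: lime_le; first by apply: is_cvg_nneseries => k _ _; exact: integral_ge0.
apply: nearW => n.
apply: (@le_trans _ _ (\sum_(0 <= k < n)
   (expR (- ltil * r) * exp_coeff (mu * lbar * r) k)%:E)%E).
  by apply: lee_sum => k _; exact: ih.
rewrite sumEFin lee_fin -mulr_sumr.
rewrite mulrBl expRD mulrC mulNr ler_pM2r ?expR_gt0//.
apply: nondecreasing_cvgn_le; last exact: is_cvg_series_exp_coeff.
apply: nondecreasing_series => k _ _; apply: exp_coeff_ge0.
by rewrite !mulr_ge0// ltW.
Qed.

End jump_moments.

(** * Comparison functions *)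

Lemma classK_ge0 (R : realType) (a : R -> R) (r : R) : classK a -> 0 <= r -> 0 <= a r.
Proof.
move=> [a0 _ amono]; rewrite le_eqVlt => /predU1P[<-|r0]; first by rewrite a0.
by rewrite -a0 ltW// amono.
Qed.

Lemma classK_le (R : realType) (a : R -> R) (r s : R) : classK a -> 0 <= r -> r <= s ->
  a r <= a s.
Proof.
move=> [_ _ amono] r0; rewrite le_eqVlt => /predU1P[->//|rs].
by rewrite ltW// amono.
Qed.

Lemma classK_scale (R : realType) (a : R -> R) (K : R) : 0 < K -> classK a ->
  classK (fun r => K * a r).
Proof.
move=> K0 [a0 ca amono]; split; first by rewrite a0 mulr0.
  by move=> x; apply: cvgM; [exact: cvg_cst|exact: ca].
by move=> r s r0 rs; rewrite ltr_pM2l// amono.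
Qed.

Lemma classKinf_scale (R : realType) (a : R -> R) (K : R) : 0 < K -> classKinf a ->
  classKinf (fun r => K * a r).
Proof.
move=> K0 [Ka ainf]; split; first exact: classK_scale.
move=> M; have [r r0 Mr] := ainf (M / K); exists r => //.
by rewrite mulrC -ltr_pdivrMr.
Qed.

(** * Growth along a switched trajectory *)

Lemma ess_norm_ge0 (R : realType) (k : nat) (d : R -> 'rV[R]_k) :
  (0 <= ess_norm d)%E.
Proof.
apply: ess_sup_gee; last by apply: aeW => t; rewrite lee_fin enorm_ge0.
by rewrite /= /mrestr setTI lebesgue_measure_itv/= ltry oppr0 addye ?ltry.
Qed.

Lemma ae_enorm_le_ess_norm (R : realType) (k : nat) (d : R -> 'rV[R]_k) :
  (ess_norm d < +oo)%E ->
  {ae @lebesgue_measure R, forall t, 0 <= t -> enorm (d t) <= fine (ess_norm d)}.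
Proof.
move=> dfin.
have := @ess_sup_ge _ _ R
  (mrestr (@lebesgue_measure R) (measurable_itv `[(0:R), +oo[))
  (fun t => (enorm (d t))%:E).
rewrite -/(ess_norm d) => -[A [mA A0 HA]].
exists (A `&` `[0, +oo[); split=> //; first exact: measurableI.
move=> t /= /not_implyP[t0 H]; split; last by rewrite /= in_itv/= t0.
apply: HA => /= H'; apply: H.
have fd : ess_norm d \is a fin_num.
  by move: dfin H'; case: (ess_norm d).
by rewrite -lee_fin fineK.
Qed.

(** Induction over the successive intervals of constancy.  Here W i t stands for
    V_i(x(t)), and mu >= 1 is used to absorb the source term accumulated after
    a jump into the factor mu of that jump. *)
Lemma njumps_growth (R : realType) (T : Type) (p : R -> T) (W : T -> R -> R)
    (mu lo b : R) (s t : R) (m : nat) :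
  1 <= mu -> 0 < lo -> 0 <= b -> 0 <= s ->
  (forall i j r, W i r <= mu * W j r) ->
  (forall s u, 0 <= s -> s <= u -> (forall r, s <= r -> r < u -> p r = p s) ->
     expR (lo * u) * (W (p s) u - b) <= expR (lo * s) * (W (p s) s - b)) ->
  njumps p s t m ->
  expR (lo * t) * W (p t) t <=
  mu ^+ m * (expR (lo * s) * W (p s) s + b * (expR (lo * t) - expR (lo * s))).
Proof.
move=> mu1 lo0 b0 s0 Wmu Wdecay J.
elim: J s0 => {s t m} [s t st cst|s u t m su cst pu J IH] s0.
  have := Wdecay s t s0 st (fun r sr rt => cst r sr (ltW rt)).
  by rewrite expr0 mul1r (cst t)//; lra.
have u0 : 0 <= u by exact: le_trans (ltW su).
apply: (le_trans (IH u0)); rewrite exprSr -mulrA.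
apply: ler_wpM2l; first by rewrite exprn_ge0//; lra.
have h1 := Wdecay s u s0 (ltW su) cst.
have h2 : expR (lo * u) * W (p u) u <= expR (lo * u) * (mu * W (p s) u).
  by apply: ler_wpM2l; [exact: expR_ge0|exact: Wmu].
have h3 : mu * (expR (lo * u) * (W (p s) u - b)) <=
          mu * (expR (lo * s) * (W (p s) s - b)) by apply: ler_wpM2l => //; lra.
have tu : expR (lo * u) <= expR (lo * t) by rewrite ler_expR ler_pM2l//; exact: njumps_le J.
have h4 : b * (expR (lo * t) - expR (lo * u)) <=
          mu * (b * (expR (lo * t) - expR (lo * u))).
  by apply: ler_peMl => //; rewrite mulr_ge0// subr_ge0.
by lra.
Qed.

(** On an interval of constancy of sigma, the differential inequality for the
    active V_i holds outside two null sets: the one where the differential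
    equation fails and the one where |d| exceeds its essential supremum. *)
Lemma switched_lyapunov_growth (R : realType) (disp : measure_display)
    (Omega : measurableType disp) (n k N : nat)
    (f : 'I_N -> 'rV[R]_n * 'rV[R]_k -> 'rV[R]_n)
    (sigma : R -> Omega -> 'I_N) (V : 'I_N -> 'rV[R]_n -> R) (chi : R -> R)
    (mu lo : R) (x0 : 'rV[R]_n) (d : R -> 'rV[R]_k) (x : R -> 'rV[R]_n)
    (w : Omega) (s t : R) :
  switching_signal sigma -> (forall i, C1 (V i)) -> classK chi ->
  1 <= mu -> 0 < lo ->
  (forall i x d, 'd (V i) x (f i (x, d)) <= - lo * V i x + chi (enorm d)) ->
  (forall i j x, V i x <= mu * V j x) ->
  (ess_norm d < +oo)%E ->
  caratheodory_solution (fun t y => f (sigma t w) (y, d t)) x0 x ->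
  0 <= s -> s <= t ->
  expR (lo * t) * V (sigma t w) (x t) <=
  mu ^+ jump_count sigma s t w *
    (expR (lo * s) * V (sigma s w) (x s) +
     chi (fine (ess_norm d)) / lo * (expR (lo * t) - expR (lo * s))).
Proof.
move=> hsigma C1V Kchi mu1 lo0 Vdecay Vmu dfin [_ acx [A [mA A0 HA]]] s0 st.
have [B [mB B0 HB]] := ae_enorm_le_ess_norm dfin.
have D0 : 0 <= fine (ess_norm d) by apply: fine_ge0; exact: ess_norm_ge0.
apply: (@njumps_growth R _ (sigma^~ w) (fun i r => V i (x r))) => //.
- by rewrite divr_ge0 ?(classK_ge0 Kchi)// ltW.
- move=> {s0 st} {}s u s0 su cst.
  apply: (@lyapunov_decay R n (V (sigma s w)) x lo (chi (fine (ess_norm d)))) => //.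
    move=> eps eps0; have u1 : 0 < u + 1 by lra.
    have [delta delta0 Hd] := acx _ u1 _ eps0; exists delta => // m v z vz.
    apply: Hd => i; have [v1 v2 v3] := vz i; split=> //; first exact: le_trans v1.
    by apply: (le_trans v3); rewrite lerDl.
  exists (A `|` B); split; [exact: measurableU|exact: null_set_setU|].
  move=> r /= H; apply: contrapT => /not_orP[nA nB]; apply: H => sr ru.
  have r0 : 0 <= r by exact: le_trans (ltW sr).
  have dx : is_derive r (1 : R) x (f (sigma s w) (x r, d r)).
    apply: contrapT => nd; apply: nA; apply: HA => /= /(_ r0).
    by rewrite (cst r (ltW sr) ru).
  have dr : enorm (d r) <= fine (ess_norm d).
    by apply: contrapT => nd; apply: nB; apply: HB => /= /(_ r0).
  exists (f (sigma s w) (x r, d r)) => //.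
  apply: (le_trans (Vdecay _ _ _)); rewrite lerD2l.
  by apply: classK_le => //; exact: enorm_ge0.
- exact: jump_countP.
Qed.

(** The times t, t - 1, t - 2, ..., stopped at 0 in order that the last step,
    which may be shorter than 1, is of the same form as the others. *)
Definition backward_grid (R : realType) (t : R) (j : nat) : R :=
  Num.max 0 (t - j%:R).

Lemma backward_grid_ge0 (R : realType) (t : R) (j : nat) : 0 <= backward_grid t j.
Proof. by rewrite /backward_grid le_max lexx. Qed.

Lemma backward_grid_le (R : realType) (t : R) (j : nat) : 0 <= t ->
  backward_grid t j <= t.
Proof. by move=> t0; rewrite /backward_grid ge_max t0 gerBl ler0n. Qed.

Lemma backward_gridS_le (R : realType) (t : R) (j : nat) :
  backward_grid t j.+1 <= backward_grid t j.
Proof.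
by rewrite /backward_grid ge_max !le_max lexx/= lerD2l lerN2 ler_nat leqnSn orbT.
Qed.

(** Iterated variation of constants: each step backwards adds the source term of
    one grid interval, weighted by all the jumps that occur after its left end.
    Iterating on the grid rather than using a single step from 0 to t is
    essential, since a single step would weight the source term of every
    interval by all the jumps on ]0, t]. *)
Lemma backward_grid_unfold (R : realType) (y : R -> R) (c : R -> R -> nat)
    (mu lo b t : R) (m : nat) :
  1 <= mu -> 0 <= b -> 0 <= t ->
  (forall s u r, 0 <= s -> s <= u -> u <= r -> c s r = (c s u + c u r)%N) ->
  (forall s u, 0 <= s -> s <= u ->
     y u <= mu ^+ c s u * (y s + b * (expR (lo * u) - expR (lo * s)))) ->
  y t <= mu ^+ c (backward_grid t m) t * y (backward_grid t m) +
    \sum_(j < m) b * expR (lo * backward_grid t j) * mu ^+ c (backward_grid t j.+1) t.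
Proof.
move=> mu1 b0 t0 cD Hy; have mu0 : 0 <= mu by lra.
elim: m => [|m IH].
  have -> : backward_grid t 0 = t by rewrite /backward_grid subr0; apply/max_idPr.
  have -> : c t t = 0%N.
    by have /eqP := cD t t t t0 (lexx _) (lexx _); rewrite -{1}[c t t]addn0 eqn_add2l => /eqP.
  by rewrite big_ord0 addr0 expr0 mul1r.
have sm0 := backward_grid_ge0 t m; have sm1 := backward_grid_ge0 t m.+1.
have smt := backward_grid_le m t0; have smS := backward_gridS_le t m.
apply: (le_trans IH); rewrite big_ord_recr /= addrA [leRHS]addrAC lerD2r.
rewrite (cD _ _ _ sm1 smS smt) exprD.
set A := mu ^+ c (backward_grid t m) t; set B := mu ^+ c (backward_grid t m.+1) _.
have A0 : 0 <= A by rewrite exprn_ge0.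
have B0 : 0 <= B by rewrite exprn_ge0.
apply: (le_trans (ler_wpM2l A0 (Hy _ _ sm1 smS))); rewrite -/B.
set E1 := expR (lo * backward_grid t m); set E0 := expR _.
rewrite -subr_ge0 [X in 0 <= X](_ : _ = b * E0 * (B * A)); last by ring.
by rewrite !mulr_ge0// expR_ge0.
Qed.

(** * Decay profiles *)

(** e^{-a s} (A + e^{(a - c) s}): the discount e^{-a s} times the bound on the
    exponential moment of the number of jumps over a time s, for A = mu^k0. *)
Definition decay_profile (R : realType) (A a c : R) (s : R) : R :=
  A * expR (- a * s) + expR (- c * s).

Lemma decay_profile_gt0 (R : realType) (A a c s : R) : 0 <= A ->
  0 < decay_profile A a c s.
Proof. by move=> A0; rewrite ltr_wpDl ?expR_gt0// mulr_ge0// expR_ge0. Qed.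

Lemma decay_profile_nincr (R : realType) (A a c s t : R) : 0 <= A -> 0 < a -> 0 < c ->
  s <= t -> decay_profile A a c t <= decay_profile A a c s.
Proof.
move=> A0 a0 c0 st; apply: lerD; last by rewrite ler_expR ler_nM2l// oppr_lt0.
by apply: ler_wpM2l => //; rewrite ler_expR ler_nM2l// oppr_lt0.
Qed.

Lemma cvg_expR_decay (R : realType) (a : R) : 0 < a ->
  expR (- a * s) @[s --> +oo] --> (0 : R).
Proof.
move=> a0.
have : expR (- (a * s)) @[s --> +oo] --> (0 : R).
  by apply: (cvg_comp _ _ _ (@cvgr_expR R)); apply: gt0_cvgMry => //; exact: cvg_id.
by under eq_fun do rewrite -mulNr.
Qed.

Lemma classKL_decay_profile (R : realType) (g : R -> R) (A a c : R) :
  classK g -> 0 <= A -> 0 < a -> 0 < c ->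
  classKL (fun r s => 2 * decay_profile A a c s * g r).
Proof.
move=> Kg A0 a0 c0; split=> [s s0|r r0].
  by apply: classK_scale => //; rewrite mulr_gt0// decay_profile_gt0.
have gr := classK_ge0 Kg r0.
split=> [s t s0 st|].
  by apply: ler_wpM2r => //; apply: ler_wpM2l => //; exact: decay_profile_nincr.
have -> : (0 : R) = 2 * (A * 0 + 0) * g r by rewrite mulr0 addr0 mulr0 mul0r.
apply: cvgM; last exact: cvg_cst.
apply: cvgM; first exact: cvg_cst.
apply: cvgD; last exact: cvg_expR_decay.
by apply: cvgM; [exact: cvg_cst|exact: cvg_expR_decay].
Qed.

Lemma geometric_sum_le (R : realType) (a : R) (m : nat) : 0 < a ->
  \sum_(j < m) expR (- a * j%:R) <= (1 - expR (- a))^-1.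
Proof.
move=> a0; have q1 : expR (- a) < 1 by rewrite expR_lt1 oppr_lt0.
have q0 := expR_ge0 (- a).
have := @geometric_le_lim R m 1 (expR (- a)) ler01 (expR_gt0 _).
rewrite ger0_norm// mul1r => /(_ q1); apply: le_trans.
rewrite /series /= big_mkord; apply: ler_sum => j _.
by rewrite mul1r expRM_natr.
Qed.

Lemma sum_decay_profile_le (R : realType) (A lo c : R) (m : nat) :
  0 <= A -> 0 < lo -> 0 < c ->
  \sum_(j < m) decay_profile A lo c j%:R <=
  A * (1 - expR (- lo))^-1 + (1 - expR (- c))^-1.
Proof.
move=> A0 lo0 c0; rewrite big_split /= -mulr_sumr; apply: lerD.
  by apply: ler_wpM2l => //; exact: geometric_sum_le.
exact: geometric_sum_le.
Qed.

(** With r the distance from the grid point j + 1 to t, the left side is at most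
    e^{lo} times the decay profile at r: the factor e^{lo} pays for the source
    term being discounted from the grid point j instead of j + 1.  Moreover
    r >= j, also when the grid has been stopped at 0. *)
Lemma backward_grid_decay (R : realType) (A lo c t : R) (j : nat) :
  0 <= A -> 0 < lo -> 0 < c -> j%:R <= t ->
  expR (- lo * t) * expR (lo * backward_grid t j) *
    (A + expR ((lo - c) * (t - backward_grid t j.+1))) <=
  expR lo * decay_profile A lo c j%:R.
Proof.
move=> A0 lo0 c0 jt; set r := t - backward_grid t j.+1.
have jr : j%:R <= r.
  rewrite /r lerBrDr -lerBrDl /backward_grid ge_max subr_ge0 jt /=.
  by rewrite lerD2l lerN2 ler_nat.
have gr : backward_grid t j - t <= 1 - r.
  rewrite /r opprB addrA lerD2r /backward_grid ge_max; apply/andP; split.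
    by rewrite addr_ge0// le_max lexx.
  by rewrite -lerBlDl le_max -addrA -natr1; apply/orP; right; lra.
clearbody r.
apply: (@le_trans _ _ (expR lo * decay_profile A lo c r)); last first.
  by apply: ler_wpM2l; [exact: expR_ge0|exact: decay_profile_nincr].
have -> : decay_profile A lo c r = expR (- lo * r) * (A + expR ((lo - c) * r)).
  rewrite /decay_profile mulrDr -expRD; congr (_ + expR _); [exact: mulrC|by ring].
rewrite mulrA; apply: ler_wpM2r; first by rewrite addr_ge0// expR_ge0.
rewrite -!expRD ler_expR mulNr addrC -mulrBr mulNr -[X in _ <= X - _]mulr1 -mulrBr.
by rewrite ler_pM2l.
Qed.

(** * Expectation of the Lyapunov function *)

(** The integral of a nonnegative function is a supremum over the simple
    functions below it, hence monotone on all nonnegative functions. *)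
Lemma ge0_le_integral_nonmeasurable (R : realType) (disp : measure_display)
    (T : measurableType disp) (mu : {measure set T -> \bar R})
    (f g : T -> \bar R) :
  (forall x, 0 <= f x)%E -> (forall x, f x <= g x)%E ->
  (\int[mu]_x f x <= \int[mu]_x g x)%E.
Proof.
move=> f0 fg; have g0 x : (0 <= g x)%E by exact: le_trans (fg x).
rewrite !ge0_integralTE//; apply: le_ereal_sup => _ [h hf <-].
by exists h => // x; exact: le_trans (fg x).
Qed.

Lemma integral_weighted_sum_le (R : realType) (disp : measure_display)
    (T : measurableType disp) (mu : {measure set T -> \bar R}) (m : nat)
    (a q : 'I_m -> R) (Q : 'I_m -> T -> R) :
  (forall j, 0 <= a j) -> (forall j x, 0 <= Q j x) ->
  (forall j, measurable_fun setT (Q j)) ->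
  (forall j, \int[mu]_x (Q j x)%:E <= (q j)%:E)%E ->
  (\int[mu]_x (\sum_(j < m) a j * Q j x)%:E <= (\sum_(j < m) a j * q j)%:E)%E.
Proof.
move=> a0 Q0 mQ HQ.
under eq_integral do rewrite -sumEFin.
rewrite ge0_integral_sum//; last 2 first.
- by move=> j; apply/measurable_EFinP; exact: measurable_funM.
- by move=> j x _; rewrite lee_fin mulr_ge0.
rewrite -sumEFin; apply: lee_sum => j _.
under eq_integral do rewrite EFinM.
rewrite ge0_integralZl_EFin//; last 2 first.
- by move=> x _; rewrite lee_fin.
- exact/measurable_EFinP.
by rewrite EFinM; apply: lee_wpmul2l => //; rewrite lee_fin.
Qed.

Lemma integral_weighted_sum_affine_le (R : realType) (disp : measure_display)
    (T : measurableType disp) (mu : {measure set T -> \bar R}) (m : nat)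
    (a0 q0 : R) (Q0 : T -> R) (a q : 'I_m -> R) (Q : 'I_m -> T -> R) :
  0 <= a0 -> (forall x, 0 <= Q0 x) -> measurable_fun setT Q0 ->
  (\int[mu]_x (Q0 x)%:E <= q0%:E)%E ->
  (forall j, 0 <= a j) -> (forall j x, 0 <= Q j x) ->
  (forall j, measurable_fun setT (Q j)) ->
  (forall j, \int[mu]_x (Q j x)%:E <= (q j)%:E)%E ->
  (\int[mu]_x (a0 * Q0 x + \sum_(j < m) a j * Q j x)%:E <=
   (a0 * q0 + \sum_(j < m) a j * q j)%:E)%E.
Proof.
move=> a00 Q00 mQ0 HQ0 ap Qp mQ HQ.
(* the leading term becomes the term of index 0 of a sum over 'I_m.+1 *)
pose ext A (u0 : A) u (j : 'I_m.+1) := oapp u u0 (unlift ord0 j).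
have extE A (u0 : A) u : (ext A u0 u ord0 = u0) * (forall j, ext A u0 u (lift ord0 j) = u j).
  by split=> [|j]; rewrite /ext ?unlift_none ?liftK.
have := @integral_weighted_sum_le R disp T mu m.+1 (ext _ a0 a) (ext _ q0 q) (ext _ Q0 Q).
rewrite big_ord_recl !extE.
under eq_bigr do rewrite !extE.
under eq_integral do (rewrite big_ord_recl !extE; under eq_bigr do rewrite !extE).
by apply=> j; rewrite /ext; case: (unlift ord0 j).
Qed.

(** The grid has m = floor(t) + 1 steps, which is what it takes to reach 0; the
    pathwise bound is then a weighted sum of exponential moments of numbers of
    jumps. *)
Lemma lyapunov_expectation_le (R : realType) (disp : measure_display)
    (Omega : measurableType disp) (P : probability Omega R) (n k N : nat)
    (f : 'I_N -> 'rV[R]_n * 'rV[R]_k -> 'rV[R]_n)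
    (sigma : R -> Omega -> 'I_N) (hsigma : switching_signal sigma)
    (lbar ltil : R) (k0 : nat) (hlbar : 0 < lbar)
    (hG : classG P sigma lbar ltil k0)
    (V : 'I_N -> 'rV[R]_n -> R) (chi : R -> R) (mu lo v0 : R)
    (hVC1 : forall i, C1 (V i)) (hV0 : forall (i : 'I_N) (x : 'rV[R]_n), 0 <= V i x)
    (hchi : classK chi) (hmu : 1 <= mu) (hlo : 0 < lo)
    (hVdecay : forall (i : 'I_N) (x : 'rV[R]_n) (d : 'rV[R]_k),
       'd (V i) x (f i (x, d)) <= - lo * V i x + chi (enorm d))
    (hVmu : forall (i j : 'I_N) (x : 'rV[R]_n), V i x <= mu * V j x)
    (hsmall : mu < (ltil + lo) / lbar)
    (x0 : 'rV[R]_n) (hv0 : forall i, V i x0 <= v0) (hv0p : 0 <= v0)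
    (d : R -> 'rV[R]_k) (hd : (ess_norm d < +oo)%E) (x : R -> Omega -> 'rV[R]_n)
    (hx : forall w, caratheodory_solution
                   (fun t y => f (sigma t w) (y, d t)) x0 (fun t => x t w))
    (t : R) (t0 : 0 <= t) (c := ltil + lo - mu * lbar) :
  (\int[P]_w (V (sigma t w) (x t w))%:E <=
   (decay_profile (mu ^+ k0) lo c t * v0 +
    chi (fine (ess_norm d)) / lo *
     (expR lo * (mu ^+ k0 * (1 - expR (- lo))^-1 + (1 - expR (- c))^-1)))%:E)%E.
Proof.
have c0 : 0 < c by rewrite /c subr_gt0 -ltr_pdivlMr.
have mu0 : 0 <= mu by lra.
have D0 : 0 <= fine (ess_norm d) by apply: fine_ge0; exact: ess_norm_ge0.
set b := chi _ / lo.
have b0 : 0 <= b by rewrite divr_ge0 ?(classK_ge0 hchi)// ltW.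
pose m := (Num.truncn t).+1.
have tm : t < m%:R by exact: truncnS_gt.
have jt (j : 'I_m) : j%:R <= t.
  apply: (@le_trans _ _ (Num.truncn t)%:R); first by rewrite ler_nat -ltnS.
  by rewrite truncn_le.
have gm : backward_grid t m = 0.
  by rewrite /backward_grid; apply/max_idPl; rewrite subr_le0 ltW.
pose Q (s : R) w : R := mu ^+ jump_count sigma s t w.
pose q (s : R) : R := mu ^+ k0 + expR ((lo - c) * (t - s)).
have Q0 s w : 0 <= Q s w by exact: exprn_ge0.
have mQ s : 0 <= s -> s <= t -> measurable_fun setT (Q s).
  by move=> s0 st; exact: (measurable_fun_jump_count hsigma (fun k => mu ^+ k)).
have HQ s : 0 <= s -> s <= t -> (\int[P]_w (Q s w)%:E <= (q s)%:E)%E.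
  move=> s0 st; rewrite /q (_ : lo - c = mu * lbar - ltil); last by rewrite /c; ring.
  exact: exp_jump_moment.
pose a (j : 'I_m) := b * (expR (- lo * t) * expR (lo * backward_grid t j)).
have a0 j : 0 <= a j.
  by apply: mulr_ge0 => //; apply: mulr_ge0; exact: expR_ge0.
apply: (@le_trans _ _ (\int[P]_w (expR (- lo * t) * v0 * Q 0 w +
    \sum_(j < m) a j * Q (backward_grid t j.+1) w)%:E)%E).
  apply: ge0_le_integral_nonmeasurable => w; rewrite lee_fin//.
  have := @backward_grid_unfold R (fun s => expR (lo * s) * V (sigma s w) (x s w))
    (fun s r => jump_count sigma s r w) mu lo b t m hmu b0 t0.
  move=> /(_ (fun s u r => @jump_countD _ _ _ _ _ hsigma s u r w)).
  move=> /(_ (fun s u s0 su => switched_lyapunov_growth hsigma hVC1 hchi hmu hlo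
      hVdecay hVmu hd (hx w) s0 su)).
  rewrite gm mulr0 expR0 mul1r; have [-> _ _] := hx w.
  move=> /(ler_wpM2l (expR_ge0 (- lo * t))).
  rewrite mulrA -expRD mulNr addNr expR0 mul1r => /le_trans; apply.
  rewrite -mulNr mulrDr; apply: lerD.
    rewrite -mulrA; apply: ler_wpM2l; first exact: expR_ge0.
    by rewrite mulrC; apply: ler_wpM2r; [exact: exprn_ge0|exact: hv0].
  rewrite mulr_sumr; apply: ler_sum => j _.
  rewrite /a /Q; suff -> : forall u v z : R, u * (b * v * z) = b * (u * v) * z by [].
  by move=> u v z; ring.
apply: le_trans.
  apply: (@integral_weighted_sum_affine_le _ _ _ _ _ _ (q 0) _ _
    (fun j => q (backward_grid t j.+1))) => //.
  - by apply: mulr_ge0 => //; exact: expR_ge0.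
  - exact: mQ.
  - exact: HQ.
  - by move=> j; apply: mQ; [exact: backward_grid_ge0|exact: backward_grid_le].
  - by move=> j; apply: HQ; [exact: backward_grid_ge0|exact: backward_grid_le].
rewrite lee_fin; apply: lerD.
  rewrite mulrAC ler_wpM2r// /q subr0 /decay_profile mulrDr -expRD.
  by rewrite mulrC lerD2l ler_expR; have -> : - lo * t + (lo - c) * t = - c * t by ring.
apply: (@le_trans _ _ (\sum_(j < m) b * (expR lo * decay_profile (mu ^+ k0) lo c j%:R))).
  apply: ler_sum => j _; rewrite /a -mulrA; apply: ler_wpM2l => //.
  by apply: backward_grid_decay => //; exact: exprn_ge0.
rewrite -!mulr_sumr; apply: ler_wpM2l => //; apply: ler_wpM2l; first exact: expR_ge0.
by apply: sum_decay_profile_le => //; exact: exprn_ge0.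
Qed.

Theorem theorem5 (R : realType) (disp : measure_display)
    (Omega : measurableType disp) (P : probability Omega R)
    (hP : measure_is_complete P)
    (n k N : nat)
    (f : 'I_N -> 'rV[R]_n * 'rV[R]_k -> 'rV[R]_n)
    (hfC1 : forall i, C1 (f i)) (hf0 : forall i, f i (0, 0) = 0)
    (sigma : R -> Omega -> 'I_N) (hsigma : switching_signal sigma)
    (sigma0 : Omega -> 'I_N) (hsigma0 : forall w, sigma 0 w = sigma0 w)
    (* G1 *)
    (lbar ltil : R) (k0 : nat) (hlbar : 0 < lbar) (hltil : 0 < ltil)
    (hG : classG P sigma lbar ltil k0)
    (* G2 *)
    (V : 'I_N -> 'rV[R]_n -> R) (alpha1 alpha2 chi : R -> R) (mu lo : R)
    (hVC1 : forall i, C1 (V i)) (hV0 : forall (i : 'I_N) (x : 'rV[R]_n), 0 <= V i x)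
    (halpha1 : classKinf alpha1) (halpha2 : classKinf alpha2)
    (hchi : classKinf chi) (hmu : 1 <= mu) (hlo : 0 < lo)
    (hVbounds : forall (i : 'I_N) (x : 'rV[R]_n),
       alpha1 (enorm x) <= V i x /\ V i x <= alpha2 (enorm x))
    (hVdecay : forall (i : 'I_N) (x : 'rV[R]_n) (d : 'rV[R]_k),
       'd (V i) x (f i (x, d)) <= - lo * V i x + chi (enorm d))
    (hVmu : forall (i j : 'I_N) (x : 'rV[R]_n), V i x <= mu * V j x)
    (* G3 *)
    (hsmall : mu < (ltil + lo) / lbar) :
  exists (beta : R -> R -> R) (alpha gamma : R -> R),
    [/\ classKL beta, classKinf alpha, classKinf gamma &
    forall (x0 : 'rV[R]_n) (d : R -> 'rV[R]_k),
      lebesgue_measurable_signal d ->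
      (ess_norm d < +oo)%E ->
    forall x : R -> Omega -> 'rV[R]_n,
      (forall w, caratheodory_solution
                   (fun t y => f (sigma t w) (y, d t)) x0 (fun t => x t w)) ->
    exists T : nat -> Omega -> \bar R,
      [/\ forall w, T 0%N w = 0%E,
          forall i, (1 <= i)%N -> optional_time (filtration_of P sigma) (T i),
          forall i w, (1 <= i)%N -> (T i w <= T i.+1 w)%E,
          {ae P, forall w, T i w @[i --> \oo] --> +oo%E} &
          forall (t : R) (i : nat), 0 <= t -> (1 <= i)%N ->
            ('E_P[fun w => (alpha (enorm (x t w)) *
                     \1_([set w' | (T i.-1 w' <= t%:E < T i w')%E] `&`
                         [set w' | (T i.-1 w' < +oo)%E]) w)%R]
             <= (Num.max (beta (enorm x0) t) (gamma (fine (ess_norm d))))%:E)%E]].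
Proof.
pose c := ltil + lo - mu * lbar.
have c0 : 0 < c by rewrite /c subr_gt0 -ltr_pdivlMr.
have A0 : 0 <= mu ^+ k0 by rewrite exprn_ge0//; lra.
pose K := expR lo * (mu ^+ k0 * (1 - expR (- lo))^-1 + (1 - expR (- c))^-1).
have geom0 (a : R) : 0 < a -> 0 < (1 - expR (- a))^-1.
  by move=> a0; rewrite invr_gt0 subr_gt0 expR_lt1 oppr_lt0.
have K0 : 0 < K.
  by rewrite mulr_gt0 ?expR_gt0// ltr_wpDl ?geom0// mulr_ge0// ltW// geom0.
exists (fun r s => 2 * decay_profile (mu ^+ k0) lo c s * alpha2 r), alpha1,
  (fun r => 2 * K / lo * chi r).
split=> //.
- by apply: classKL_decay_profile => //; case: halpha2.
- by apply: classKinf_scale => //; rewrite divr_gt0// mulr_gt0.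
move=> x0 d _ hd x hx.
exists (fun i _ => if i is 0%N then 0%E else +oo%E); split=> //.
- move=> [//|i] _; split=> // t t0.
  rewrite (_ : mkset _ = set0); first exact: (filtration_setT_set0 _ _ _).2.
  by apply/seteqP; split=> // w /=; rewrite ltNge leey.
- by move=> [|i] w.
- by apply: aeW => w; apply: cvg_near_cst; exists 1%N => // -[].
move=> t i t0 _.
have alpha_ge0 w : 0 <= alpha1 (enorm (x t w)).
  by apply: classK_ge0; [case: halpha1|exact: enorm_ge0].
have hv0 j : V j x0 <= alpha2 (enorm x0) by have [] := hVbounds j x0.
have hv0p : 0 <= alpha2 (enorm x0).
  by apply: classK_ge0; [case: halpha2|exact: enorm_ge0].
have Kchi : classK chi by case: hchi.
have bound := lyapunov_expectation_le hsigma hlbar hG hVC1 hV0 Kchi hmu hlo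
  hVdecay hVmu hsmall hv0 hv0p hd hx t0.
rewrite unlock; apply: (le_trans (le_trans _ bound)).
  apply: ge0_le_integral_nonmeasurable => w; rewrite lee_fin.
    by rewrite mulr_ge0.
  apply: le_trans (hVbounds (sigma t w) (x t w)).1.
  by rewrite -[leRHS]mulr1 ler_wpM2l// indicE; case: (_ \in _).
rewrite lee_fin -/K; set u := decay_profile _ _ _ _ * _; set v := chi _ / lo * K.
(* a sum u + v is at most max (2 u) (2 v) *)
have -> : 2 * decay_profile (mu ^+ k0) lo c t * alpha2 (enorm x0) = 2 * u.
  by rewrite /u mulrA.
have -> : 2 * K / lo * chi (fine (ess_norm d)) = 2 * v by rewrite /v; ring.
by rewrite le_max; have [uv|vu] := leP u v; apply/orP; [right|left]; lra.
Qed.
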